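(* Let $\mathcal{D}$ be a triangulated category with arbitrary coproducts, and let $S$ be an object of $\mathcal{D}$ such that the graded endomorphism ring $R_*=\pi_*S$ is graded commutative and concentrated in even degrees. Then the generating hypothesis is true in $\mathcal{D}$ (with respect to $S$) if and only if $R_*$ is regular as a graded ring, i.e. for every integer $k$ and every $x\in R_k$ there exists $y\in R_{-k}$ such that $xyx=x$.
   Context: For an object $S$ of a triangulated category $\mathcal{D}$ with suspension $\Sigma$, write $\pi_i X=[S,X]_i=\operatorname{Hom}_{\mathcal{D}}(\Sigma^i S,X)$ for $i\in\mathbb{Z}$ and $\pi_*X=\bigoplus_i\pi_iX$; $\pi_*S$ is a graded ring under composition. The thick subcategory $\mathbf{thick}\langle S\rangle$ is the smallest class of objects of $\mathcal{D}$ containing $S$ and closed under (de)suspension, retracts, and cofiber sequences (if two of three objects in an exact triangle belong to it, so does the third). The generating hypothesis in $\mathcal{D}$ (with respect to $S$) is the statement: if $f:X\to Y$ is a morphism between objects of $\mathbf{thick}\langle S\rangle$ and $\pi_*f=0$, then $f=0$. *)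

(* Defs.v *)
From HB Require Import structures.
From mathcomp Require Import all_boot all_order all_algebra.

Set Implicit Arguments.
Unset Strict Implicit.
Unset Printing Implicit Defensive.

Import GRing.Theory.
Local Open Scope ring_scope.

Declare Scope cat_scope.
Delimit Scope cat_scope with cat.

Record additiveCategory := AdditiveCategory {
  obj :> Type;
  Hom : obj -> obj -> zmodType;
  idm : forall X, Hom X X;
  comp : forall X Y Z, Hom Y Z -> Hom X Y -> Hom X Z;
  compA : forall X Y Z W (h : Hom Z W) (g : Hom Y Z) (f : Hom X Y),
    comp h (comp g f) = comp (comp h g) f;
  comp1m : forall X Y (f : Hom X Y), comp (idm Y) f = f;
  compm1 : forall X Y (f : Hom X Y), comp f (idm X) = f;
  compDl : forall X Y Z (g g' : Hom Y Z) (f : Hom X Y),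
    comp (g + g') f = comp g f + comp g' f;
  compDr : forall X Y Z (g : Hom Y Z) (f f' : Hom X Y),
    comp g (f + f') = comp g f + comp g f';
  (* In a preadditive category an object is zero iff its identity vanishes. *)
  zero_obj_exists : exists Z, idm Z = 0;
  biproduct_exists : forall X Y,
    exists (P : obj) (i1 : Hom X P) (i2 : Hom Y P)
           (p1 : Hom P X) (p2 : Hom P Y),
      [/\ comp p1 i1 = idm X, comp p2 i2 = idm Y
        & comp i1 p1 + comp i2 p2 = idm P]
}.

Arguments idm {a} X : rename.
Notation "g ∘ f" := (comp g f) (at level 40, left associativity) : cat_scope.
Local Open Scope cat_scope.

Definition is_iso (C : additiveCategory) (X Y : C) (f : Hom X Y) : Prop :=
  exists g : Hom Y X, g ∘ f = idm X /\ f ∘ g = idm Y.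

(* The suspension is recorded through all its integer powers: [shift i] is    *)
(* Sigma^i, an additive functor, with coherent natural isomorphisms           *)
(* Sigma^0 X ~ X and Sigma^(i+j) X ~ Sigma^i (Sigma^j X); in particular       *)
(* Sigma = [shift 1] is an autoequivalence with quasi-inverse [shift (-1)].   *)
(* Every autoequivalence extends to such a family.  In [shiftD] the sum is a  *)
(* variable [l] with a proof of [i + j = l], so that no cast along equalities *)
(* of integers is needed in the coherence laws.                               *)
Record shiftCategory := ShiftCategory {
  scat :> additiveCategory;
  shift : int -> scat -> scat;
  smap : forall (i : int) (X Y : scat),
    Hom X Y -> Hom (shift i X) (shift i Y);
  smap1 : forall i (X : scat), smap i (idm X) = idm (shift i X);
  smapM : forall i (X Y Z : scat) (g : Hom Y Z) (f : Hom X Y),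
    smap i (g ∘ f) = smap i g ∘ smap i f;
  smapD : forall i (X Y : scat) (f g : Hom X Y),
    smap i (f + g) = smap i f + smap i g;
  shift0 : forall X : scat, Hom (shift 0 X) X;
  shiftD : forall (i j l : int), i + j = l ->
    forall X : scat, Hom (shift l X) (shift i (shift j X));
  shift0_iso : forall X, is_iso (shift0 X);
  shift0_nat : forall (X Y : scat) (f : Hom X Y),
    f ∘ shift0 X = shift0 Y ∘ smap 0 f;
  shiftD_iso : forall i j l (e : i + j = l) X, is_iso (shiftD e X);
  shiftD_nat : forall i j l (e : i + j = l) (X Y : scat) (f : Hom X Y),
    smap i (smap j f) ∘ shiftD e X = shiftD e Y ∘ smap l f;
  shiftD0l : forall j (e : 0 + j = j) X,
    shift0 (shift j X) ∘ shiftD e X = idm (shift j X);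
  shiftD0r : forall i (e : i + 0 = i) X,
    smap i (shift0 X) ∘ shiftD e X = idm (shift i X);
  shiftDA : forall i j k ij jk l (e1 : i + j = ij) (e2 : ij + k = l)
      (e3 : j + k = jk) (e4 : i + jk = l) X,
    shiftD e1 (shift k X) ∘ shiftD e2 X
    = smap i (shiftD e3 X) ∘ shiftD e4 X
}.

Notation Susp X := (shift 1 X).

Record triangulatedCategory := TriangulatedCategory {
  tcat :> shiftCategory;
  (* [exact f g h]: X -f-> Y -g-> Z -h-> Sigma X is an exact triangle *)
  exact : forall X Y Z : tcat,
    Hom X Y -> Hom Y Z -> Hom Z (Susp X) -> Prop;
  exact_isom : forall (X Y Z X' Y' Z' : tcat)
      (f : Hom X Y) (g : Hom Y Z) (h : Hom Z (Susp X))
      (f' : Hom X' Y') (g' : Hom Y' Z') (h' : Hom Z' (Susp X'))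
      (a : Hom X X') (b : Hom Y Y') (c : Hom Z Z'),
    exact f g h -> is_iso a -> is_iso b -> is_iso c ->
    b ∘ f = f' ∘ a -> c ∘ g = g' ∘ b -> smap 1 a ∘ h = h' ∘ c ->
    exact f' g' h';
  exact_id : forall X Z : tcat, idm Z = 0 ->
    exact (idm X) (0 : Hom X Z) (0 : Hom Z (Susp X));
  exact_cone : forall (X Y : tcat) (f : Hom X Y),
    exists (Z : tcat) (g : Hom Y Z) (h : Hom Z (Susp X)), exact f g h;
  exact_rot : forall (X Y Z : tcat)
      (f : Hom X Y) (g : Hom Y Z) (h : Hom Z (Susp X)),
    exact f g h <-> exact g h (- smap 1 f);
  exact_map : forall (X Y Z X' Y' Z' : tcat)
      (f : Hom X Y) (g : Hom Y Z) (h : Hom Z (Susp X))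
      (f' : Hom X' Y') (g' : Hom Y' Z') (h' : Hom Z' (Susp X'))
      (a : Hom X X') (b : Hom Y Y'),
    exact f g h -> exact f' g' h' -> b ∘ f = f' ∘ a ->
    exists c : Hom Z Z', c ∘ g = g' ∘ b /\ smap 1 a ∘ h = h' ∘ c;
  octahedral : forall (X Y Z A B C : tcat)
      (f : Hom X Y) (f' : Hom Y A) (f'' : Hom A (Susp X))
      (g : Hom Y Z) (g' : Hom Z C) (g'' : Hom C (Susp Y))
      (h' : Hom Z B) (h'' : Hom B (Susp X)),
    exact f f' f'' -> exact g g' g'' -> exact (g ∘ f) h' h'' ->
    exists (u : Hom A B) (v : Hom B C),
      [/\ exact u v (smap 1 f' ∘ g''),
          u ∘ f' = h' ∘ g, h'' ∘ u = f'', v ∘ h' = g'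
        & g'' ∘ v = smap 1 f ∘ h'']
}.

Definition has_coproducts (C : additiveCategory) : Prop :=
  forall (I : Type) (X : I -> C),
    exists (P : C) (inj : forall i, Hom (X i) P),
      forall (Y : C) (f : forall i, Hom (X i) Y),
        exists! g : Hom P Y, forall i, g ∘ inj i = f i.

(* A graded ring is given by its homogeneous components; as for [shiftD], the *)
(* degree of a product is a variable with a proof that it is the right sum.   *)
Record gradedRing := GradedRing {
  gcomp :> int -> zmodType;
  gone : gcomp 0;
  gmul : forall i j l, i + j = l -> gcomp i -> gcomp j -> gcomp l;
  gmulDl : forall i j l (e : i + j = l) x x' y,
    gmul e (x + x') y = gmul e x y + gmul e x' y;
  gmulDr : forall i j l (e : i + j = l) x y y',
    gmul e x (y + y') = gmul e x y + gmul e x y';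
  gmul1x : forall j (e : 0 + j = j) x, gmul e gone x = x;
  gmulx1 : forall i (e : i + 0 = i) x, gmul e x gone = x;
  gmulA : forall i j k ij jk l (e1 : i + j = ij) (e2 : ij + k = l)
      (e3 : j + k = jk) (e4 : i + jk = l) x y z,
    gmul e4 x (gmul e3 y z) = gmul e2 (gmul e1 x y) z
}.

Definition graded_commutative (R : gradedRing) : Prop :=
  forall (i j l : int) (e : i + j = l) (e' : j + i = l) (x : R i) (y : R j),
    gmul e x y = gmul e' y x *~ (-1) ^+ `|(i * j)%R|%N.

Definition even_graded (R : gradedRing) : Prop :=
  forall (i : int) (x : R i), odd `|i|%N -> x = 0.

Definition graded_regular (R : gradedRing) : Prop :=
  forall (k : int) (x : R k), exists y : R (- k),
    gmul (add0r k) (gmul (subrr k) x y) x = x.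

Section GeneratingHypothesis.
Variables (D : triangulatedCategory) (S : D).

Definition homotopy (i : int) (X : D) : zmodType := Hom (shift i S) X.

Definition homotopy_mul (i j l : int) (e : i + j = l)
    (x : homotopy i S) (y : homotopy j S) : homotopy l S :=
  x ∘ smap i y ∘ shiftD e S.

Lemma homotopy_mulDl i j l (e : i + j = l) x x' y :
  homotopy_mul e (x + x') y = homotopy_mul e x y + homotopy_mul e x' y.
Proof. by rewrite /homotopy_mul !compDl. Qed.

Lemma homotopy_mulDr i j l (e : i + j = l) x y y' :
  homotopy_mul e x (y + y') = homotopy_mul e x y + homotopy_mul e x y'.
Proof. by rewrite /homotopy_mul smapD compDr compDl. Qed.

Lemma homotopy_mul1x j (e : 0 + j = j) x : homotopy_mul e (shift0 S) x = x.
Proof. by rewrite /homotopy_mul -shift0_nat -compA shiftD0l compm1. Qed.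

Lemma homotopy_mulx1 i (e : i + 0 = i) x : homotopy_mul e x (shift0 S) = x.
Proof. by rewrite /homotopy_mul -compA shiftD0r compm1. Qed.

Lemma homotopy_mulA i j k ij jk l (e1 : i + j = ij) (e2 : ij + k = l)
    (e3 : j + k = jk) (e4 : i + jk = l) x y z :
  homotopy_mul e4 x (homotopy_mul e3 y z)
  = homotopy_mul e2 (homotopy_mul e1 x y) z.
Proof.
rewrite /homotopy_mul !smapM -!compA -(shiftDA e1 e2 e3 e4).
by rewrite (compA (shiftD e1 S)) -shiftD_nat !compA.
Qed.

Definition homotopy_ring : gradedRing :=
  GradedRing homotopy_mulDl homotopy_mulDr
    homotopy_mul1x homotopy_mulx1 homotopy_mulA.

Record thick_class (P : D -> Prop) : Prop := ThickClass {
  thick_susp : forall X, P X -> P (shift 1 X);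
  thick_desusp : forall X, P X -> P (shift (-1) X);
  thick_retract : forall (X Y : D) (i : Hom X Y) (r : Hom Y X),
    r ∘ i = idm X -> P Y -> P X;
  thick_exact3 : forall (X Y Z : D)
      (f : Hom X Y) (g : Hom Y Z) (h : Hom Z (Susp X)),
    exact f g h -> P X -> P Y -> P Z;
  thick_exact2 : forall (X Y Z : D)
      (f : Hom X Y) (g : Hom Y Z) (h : Hom Z (Susp X)),
    exact f g h -> P X -> P Z -> P Y;
  thick_exact1 : forall (X Y Z : D)
      (f : Hom X Y) (g : Hom Y Z) (h : Hom Z (Susp X)),
    exact f g h -> P Y -> P Z -> P X
}.

Definition thick (X : D) : Prop :=
  forall P : D -> Prop, thick_class P -> P S -> P X.

Definition generating_hypothesis : Prop :=
  forall (X Y : D) (f : Hom X Y), thick X -> thick Y ->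
    (forall (i : int) (x : homotopy i X), f ∘ x = 0) -> f = 0.

End GeneratingHypothesis.

(* Main.v *)
From mathcomp Require Import all_boot all_order all_algebra.
From mathcomp Require Import zify.
Require Import Defs.

(** Write [R] for the graded ring [homotopy_ring S].

If [R] is regular, consider the class [shift_summand] of summands of finite
sums of shifts of [S].  A map between two shifts of [S] is an element of [R],
and the argument of von Neumann for matrices over a regular ring shows that
every map [f] of the class has a quasi-inverse: [f ∘ k ∘ f = f]
([shift_summand_regular]).  The triangle of such an [f : X -> Y] splits enough
to make its cone a summand of [Y] plus [Susp X] ([cone_regular_sum]), so the
class is thick and contains [thick S].  A map out of a summand of a sum of
shifts of [S] is determined by its effect on homotopy, which is the generating
hypothesis.

Conversely, assume the generating hypothesis.  As [R] is graded commutative and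
even, its homogeneous elements commute without signs.  Two maps that are zero on
homotopy, hence zero, give regularity.

- [R] is reduced ([homotopy_ring_reduced]).  If [n * n = 0], the suspension of
  [n] lifts to the cone of [n]; composed with the boundary map of the cone of
  the shifted [n], the lift is zero on homotopy.  In even degrees this
  holds because the boundary map lands in an odd shift of [S]; in odd degrees
  because what remains comes from homotopy of [S] in odd degree.  That the
  composite vanishes provides [w] in degree 0 with [w * n = n] and
  [n * w = 0], so [n = 0].

- For [x] in [R], let [h] be the boundary map of the cone of [x * x]; on
  homotopy its image is the annihilator of [x * x].  By reducedness [x] kills
  that annihilator, so [x] composed with [h] is zero on homotopy.  Its vanishing
  says that [x] factors through [x * x], that is, [x = y * (x * x)]
  ([homotopy_ring_regular]). *)

Set Implicit Arguments.
Unset Strict Implicit.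
Unset Printing Implicit Defensive.

Import GRing.Theory.
Local Open Scope ring_scope.
Local Open Scope cat_scope.

(** * Quasi-inverses in an additive category *)

Section AdditiveCategory.
Variable C : additiveCategory.
Implicit Types X Y Z W : C.

Lemma comp0m X Y Z (f : Hom X Y) : (0 : Hom Y Z) ∘ f = 0.
Proof. by apply: (addrI (0 ∘ f)); rewrite -compDl !addr0. Qed.

Lemma compm0 X Y Z (g : Hom Y Z) : g ∘ (0 : Hom X Y) = 0.
Proof. by apply: (addrI (g ∘ 0)); rewrite -compDr !addr0. Qed.

Lemma compNm X Y Z (g : Hom Y Z) (f : Hom X Y) : (- g) ∘ f = - (g ∘ f).
Proof. by apply: (addrI (g ∘ f)); rewrite -compDl !subrr comp0m. Qed.

Lemma compmN X Y Z (g : Hom Y Z) (f : Hom X Y) : g ∘ (- f) = - (g ∘ f).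
Proof. by apply: (addrI (g ∘ f)); rewrite -compDr !subrr compm0. Qed.

Lemma compBl X Y Z (g g' : Hom Y Z) (f : Hom X Y) :
  (g - g') ∘ f = g ∘ f - g' ∘ f.
Proof. by rewrite compDl compNm. Qed.

Lemma compBr X Y Z (g : Hom Y Z) (f f' : Hom X Y) :
  g ∘ (f - f') = g ∘ f - g ∘ f'.
Proof. by rewrite compDr compmN. Qed.

Lemma iso_epi X Y Z (f : Hom X Y) (g g' : Hom Y Z) :
  is_iso f -> g ∘ f = g' ∘ f -> g = g'.
Proof.
by move=> [k [_ fk]] gf; rewrite -(compm1 g) -fk compA gf -compA fk compm1.
Qed.

Lemma iso_mono X Y Z (f : Hom Y Z) (g g' : Hom X Y) :
  is_iso f -> f ∘ g = f ∘ g' -> g = g'.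
Proof.
by move=> [k [kf _]] fg; rewrite -(comp1m g) -kf -compA fg compA kf comp1m.
Qed.

Definition regular_map X Y (f : Hom X Y) : Prop :=
  exists g : Hom Y X, f ∘ g ∘ f = f.

Definition regular_pair X Y : Prop := forall f : Hom X Y, regular_map f.

(** A quasi-inverse of the row [(a, b)]: split off the image of [a] with the
idempotent [e = a ∘ a'], and treat the part [(1 - e) ∘ b] of [b] outside that
image.  The endomorphism built from [g1] and [g2] is
[e + (1 - e) ∘ b ∘ c ∘ (1 - e)], where [c] is a quasi-inverse of [(1 - e) ∘ b];
it restricts to the identity on [a] and on [b]. *)
Lemma regular_row X1 X2 Y (a : Hom X1 Y) (b : Hom X2 Y) :
  regular_pair X1 Y -> regular_pair X2 Y ->
  exists (g1 : Hom Y X1) (g2 : Hom Y X2),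
    (a ∘ g1 + b ∘ g2) ∘ a = a /\ (a ∘ g1 + b ∘ g2) ∘ b = b.
Proof.
move=> reg1 reg2; have [a' aa'a] := reg1 a.
have [c bcb] := reg2 ((idm Y - a ∘ a') ∘ b).
exists (a' ∘ (idm Y - b ∘ (c ∘ (idm Y - a ∘ a')))), (c ∘ (idm Y - a ∘ a')).
have -> : a ∘ (a' ∘ (idm Y - b ∘ (c ∘ (idm Y - a ∘ a'))))
      + b ∘ (c ∘ (idm Y - a ∘ a'))
    = a ∘ a' + (idm Y - a ∘ a') ∘ b ∘ c ∘ (idm Y - a ∘ a').
  have [d def_d] : exists d, d = idm Y - a ∘ a' by eexists.
  rewrite -def_d.
  rewrite compA compBr compm1 -addrA -!compA; congr (_ + _).
  by rewrite {3}def_d compBl comp1m addrC -!compA.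
split; rewrite compDl.
  by rewrite -[_ ∘ _ ∘ a in X in _ + X]compA [(_ - _) ∘ a]compBl comp1m aa'a subrr compm0 addr0.
by rewrite -[_ ∘ _ ∘ b in X in _ + X]compA bcb -compDl addrC subrK comp1m.
Qed.

(** The hypothesis says that [X] is a retract of the sum of [X1] and [X2], so the
lemma covers sums and retracts at once. *)
Lemma regular_pair_suml X1 X2 X Y (i1 : Hom X1 X) (i2 : Hom X2 X)
    (p1 : Hom X X1) (p2 : Hom X X2) :
  i1 ∘ p1 + i2 ∘ p2 = idm X ->
  regular_pair X1 Y -> regular_pair X2 Y -> regular_pair X Y.
Proof.
move=> ip reg1 reg2 f.
have [g1 [g2 [fga fgb]]] := regular_row (f ∘ i1) (f ∘ i2) reg1 reg2.
exists (i1 ∘ g1 + i2 ∘ g2); rewrite compDr !compA.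
move: (_ + _) fga fgb => fg; rewrite !compA => fga fgb.
by rewrite -[LHS]compm1 -ip compDr !compA fga fgb -!compA -compDr ip compm1.
Qed.

(** Dual to [regular_row], with the idempotent [e = a' ∘ a] on the source. *)
Lemma regular_column X Y1 Y2 (a : Hom X Y1) (b : Hom X Y2) :
  regular_pair X Y1 -> regular_pair X Y2 ->
  exists (g1 : Hom Y1 X) (g2 : Hom Y2 X),
    a ∘ (g1 ∘ a + g2 ∘ b) = a /\ b ∘ (g1 ∘ a + g2 ∘ b) = b.
Proof.
move=> reg1 reg2; have [a' aa'a] := reg1 a.
have [c bcb] := reg2 (b ∘ (idm X - a' ∘ a)).
exists ((idm X - (idm X - a' ∘ a) ∘ c ∘ b) ∘ a'), ((idm X - a' ∘ a) ∘ c).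
have -> : (idm X - (idm X - a' ∘ a) ∘ c ∘ b) ∘ a' ∘ a
      + (idm X - a' ∘ a) ∘ c ∘ b
    = a' ∘ a + (idm X - a' ∘ a) ∘ (c ∘ (b ∘ (idm X - a' ∘ a))).
  have [d def_d] : exists d, d = idm X - a' ∘ a by eexists.
  rewrite -def_d.
  rewrite -[_ ∘ a' ∘ a]compA compBl comp1m -addrA !compA; congr (_ + _).
  by rewrite {4}def_d compBr compm1 addrC !compA.
split; rewrite compDr.
  by rewrite [a ∘ (_ ∘ (_ ∘ _))]compA [a ∘ (_ - _)]compBr compm1 !compA aa'a subrr !comp0m addr0.
by rewrite [b ∘ (_ ∘ (_ ∘ _))]compA [_ ∘ (c ∘ _)]compA bcb -compDr addrC subrK compm1.
Qed.

Lemma regular_pair_sumr X Y1 Y2 Y (i1 : Hom Y1 Y) (i2 : Hom Y2 Y)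
    (p1 : Hom Y Y1) (p2 : Hom Y Y2) :
  i1 ∘ p1 + i2 ∘ p2 = idm Y ->
  regular_pair X Y1 -> regular_pair X Y2 -> regular_pair X Y.
Proof.
move=> ip reg1 reg2 f.
have [g1 [g2 [agf bgf]]] := regular_column (p1 ∘ f) (p2 ∘ f) reg1 reg2.
exists (g1 ∘ p1 + g2 ∘ p2); rewrite -compA compDl -!compA.
move: (_ + _) agf bgf => gf; rewrite -!compA => agf bgf.
by rewrite -[LHS]comp1m -ip compDl -!compA agf bgf !compA -compDl ip comp1m.
Qed.

Lemma regular_map_compiso X Y Z (f : Hom Y Z) (k : Hom X Y) :
  is_iso k -> regular_map (f ∘ k) -> regular_map f.
Proof.
move=> k_iso [g fgf]; exists (k ∘ g); apply: (iso_epi k_iso).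
by rewrite -[RHS]fgf !compA.
Qed.

End AdditiveCategory.

(** * Shifts *)

Section ShiftCategory.
Variable C : shiftCategory.
Implicit Types X Y Z : C.

Lemma smap0 i X Y : smap i (0 : Hom X Y) = 0.
Proof. by apply: (addrI (smap i 0)); rewrite -smapD !addr0. Qed.

(** [shift (- i)] after [shift i] is isomorphic to the identity. *)
Lemma smap_inj i X Y : injective (@smap C i X Y).
Proof.
move=> f g fg; have e : - i + i = 0 by rewrite addNr.
apply: (iso_epi (shift0_iso X)); rewrite !shift0_nat; congr (_ ∘ _).
by apply: (iso_mono (shiftD_iso e Y)); rewrite -!shiftD_nat fg.
Qed.

(** Transport [shift (- i) g] along the isomorphism of [shift (- i)] after
[shift i] with the identity; that this is a preimage of [g] follows from
faithfulness of [shift (- i)]. *)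
Lemma smap_full i X Y (g : Hom (shift i X) (shift i Y)) :
  exists f : Hom X Y, smap i f = g.
Proof.
have e : - i + i = 0 by rewrite addNr.
have [d [dD Dd]] := shiftD_iso e Y.
have [s [s0 ss0]] := shift0_iso X.
exists (shift0 Y ∘ d ∘ smap (- i) g ∘ shiftD e X ∘ s).
set f := (f in smap i f = _).
apply: (@smap_inj (- i)); apply: (iso_epi (shiftD_iso e X)).
rewrite shiftD_nat; have -> : smap 0 f = d ∘ smap (- i) g ∘ shiftD e X.
  apply: (iso_mono (shift0_iso Y)); rewrite -shift0_nat /f.
  by rewrite -[LHS]compA s0 compm1 !compA.
by rewrite !compA Dd comp1m.
Qed.

(** For [X = S]: maps between shifts of [S] are shifts of elements of the homotopy
ring, up to the coherence isomorphism. *)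
Lemma hom_shift m k i (e : m + k = i) (S X : C) (f : Hom (shift i S) (shift m X)) :
  exists r : Hom (shift k S) X, f = smap m r ∘ shiftD e S.
Proof.
have [d [dD _]] := shiftD_iso e S.
by have [r rE] := smap_full (f ∘ d); exists r; rewrite rE -compA dD compm1.
Qed.

Lemma smap_regular i X Y (f : Hom X Y) : regular_map f -> regular_map (smap i f).
Proof. by move=> [g fgf]; exists (smap i g); rewrite -!smapM fgf. Qed.

End ShiftCategory.

(** * Exact triangles *)

Section TriangulatedCategory.
Variable D : triangulatedCategory.
Implicit Types X Y Z W : D.

(** The triangle of the identity of [X], whose third object is zero, maps to the
given one. *)
Lemma exact_comp0 X Y Z (f : Hom X Y) (g : Hom Y Z) (h : Hom Z (Susp X)) :
  exact f g h -> g ∘ f = 0.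
Proof.
move=> fgh; have [O O0] := zero_obj_exists D.
have ff : f ∘ idm X = f ∘ idm X by [].
have [c [cg _]] := exact_map (exact_id X O0) fgh ff.
by rewrite -cg compm0.
Qed.

Lemma exact_comp0_susp X Y Z (f : Hom X Y) (g : Hom Y Z) (h : Hom Z (Susp X)) :
  exact f g h -> smap 1 f ∘ h = 0.
Proof.
move=> /exact_rot/exact_rot/exact_comp0/eqP.
by rewrite compNm oppr_eq0 => /eqP.
Qed.

(** Weak cokernels: map the given triangle to the triangle with middle map
[idm W] and zero first object. *)
Lemma exact_extend X Y Z W (f : Hom X Y) (g : Hom Y Z) (h : Hom Z (Susp X))
    (u : Hom Y W) :
  exact f g h -> u ∘ f = 0 -> exists v : Hom Z W, u = v ∘ g.
Proof.
move=> fgh uf; have [O O0] := zero_obj_exists D.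
have SO0 : idm (Susp O) = 0 by rewrite -smap1 O0 smap0.
have T : exact (0 : Hom O W) (idm W) 0.
  by apply/exact_rot; rewrite smap0 oppr0; apply: exact_id.
have uf' : u ∘ f = 0 ∘ (0 : Hom X O) by rewrite comp0m.
have [v [vg _]] := exact_map fgh T uf'.
by exists v; rewrite vg comp1m.
Qed.

(** Weak kernels: map the rotated triangle of the identity of [W] to the rotated
given one.  The third component is a map of suspensions, hence a suspension
[smap 1 v]. *)
Lemma exact_lift X Y Z W (f : Hom X Y) (g : Hom Y Z) (h : Hom Z (Susp X))
    (u : Hom W Y) :
  exact f g h -> g ∘ u = 0 -> exists v : Hom W X, u = f ∘ v.
Proof.
move=> /exact_rot fgh gu; have [O O0] := zero_obj_exists D.
have /exact_rot T := exact_id W O0.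
have gu' : (0 : Hom O Z) ∘ 0 = g ∘ u by rewrite comp0m.
have [c [_ cu]] := exact_map T fgh gu'.
have [v vc] := smap_full c; exists v; apply: (@smap_inj _ 1).
apply: oppr_inj; rewrite smapM vc -compNm -cu.
by rewrite smap1 compmN compm1.
Qed.

(** With [f ∘ k ∘ f = f], the map [1 - f ∘ k] vanishes on [f], so it is
[s ∘ g]; then [1 - g ∘ s] vanishes on [g], so it is [t ∘ h]. *)
Lemma cone_regular_sum X Y Z (f : Hom X Y) (g : Hom Y Z) (h : Hom Z (Susp X)) :
  exact f g h -> regular_map f ->
  exists (s : Hom Z Y) (t : Hom (Susp X) Z), g ∘ s + t ∘ h = idm Z.
Proof.
move=> fgh [k fkf].
have [|s sg] := @exact_extend _ _ _ _ _ _ _ (idm Y - f ∘ k) fgh.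
  by rewrite compBl comp1m fkf subrr.
have gf := exact_comp0 fgh; move/exact_rot: fgh => ghf.
have [|t th] := @exact_extend _ _ _ _ _ _ _ (idm Z - g ∘ s) ghf.
  by rewrite compBl comp1m -compA -sg compBr compm1 compA gf comp0m subr0 subrr.
by exists s, t; rewrite -th addrC subrK.
Qed.

End TriangulatedCategory.

(** * Thick classes *)

Section ThickClass.
Variables (D : triangulatedCategory) (P : D -> Prop).

Lemma thick_iso X Y (f : Hom X Y) : thick_class P -> is_iso f -> P X -> P Y.
Proof. by move=> tP [g [_ fg]]; apply: thick_retract tP _ _ g f fg. Qed.

Lemma thick_shift i X : thick_class P -> P X -> P (shift i X).
Proof.
move=> tP PX; elim/int_rect: i => [|n Pn|n Pn].
- have [s [s0 ss0]] := shift0_iso X.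
  by apply: (@thick_iso _ _ s) => //; exists (shift0 X).
- have e : 1 + n%:Z = n.+1 by lia.
  have [d [dD Dd]] := shiftD_iso e X.
  by apply: (@thick_iso _ _ d) (thick_susp tP Pn) => //; exists (shiftD e X).
- have e : -1 + - n%:Z = - n.+1%:Z by lia.
  have [d [dD Dd]] := shiftD_iso e X.
  by apply: (@thick_iso _ _ d) (thick_desusp tP Pn) => //; exists (shiftD e X).
Qed.

(** Each of the other two objects of a triangle is, up to suspension, the cone of
a map of the rotated triangle. *)
Lemma thick_class_of_cones :
  (forall X i, P X -> P (shift i X)) ->
  (forall (X Y : D) (i : Hom X Y) (r : Hom Y X), r ∘ i = idm X -> P Y -> P X) ->
  (forall (X Y Z : D) (f : Hom X Y) (g : Hom Y Z) (h : Hom Z (Susp X)),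
    exact f g h -> P X -> P Y -> P Z) ->
  thick_class P.
Proof.
move=> Pshift Pretract Pcone.
have Pdesusp X : P (Susp X) -> P X.
  move=> /(Pshift _ (-1)) PX; have e : -1 + 1 = 0 :> int by [].
  have [d [dD Dd]] := shiftD_iso e X.
  have [s [s0 ss0]] := shift0_iso X.
  apply: (Pretract _ _ (shiftD e X ∘ s) (shift0 X ∘ d)) PX.
  by rewrite !compA -(compA _ d) dD compm1.
split=> [X|X|||X Y Z f g h|X Y Z f g h] //; try exact: Pshift.
  move=> fgh PX PZ; apply: Pdesusp.
  move/exact_rot/exact_rot: fgh => hf.
  by apply: Pcone hf _ _ => //; apply: Pshift.
by move=> /exact_rot ghf PY PZ; apply: Pdesusp; apply: Pcone ghf _ _.
Qed.

End ThickClass.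

(** * From regularity to the generating hypothesis *)

Section RegularImpliesGeneratingHypothesis.
Variables (D : triangulatedCategory) (S : D).
Hypothesis R_regular : graded_regular (homotopy_ring S).

(** A map from [shift i S] to [shift j S] is the shift of an element [r] of degree
[i - j].  An element [s] of the opposite degree with [r * s * r = r], shifted by
[i - j], is a map from [S] to [shift (i - j) S] that is a quasi-inverse of [r]. *)
Lemma regular_pair_shift i j : regular_pair (shift i S) (shift j S).
Proof.
move=> f; have e : j + (i - j) = i by lia.
have [r ->] := hom_shift e f.
have [d [dD Dd]] := shiftD_iso e S.
apply: (@regular_map_compiso _ _ _ _ _ d); first by exists (shiftD e S).
rewrite -compA Dd compm1; apply: smap_regular.
have [s /= rsr] := R_regular r; have [t [t0 tt0]] := shift0_iso S.
exists (smap _ s ∘ shiftD (subrr (i - j)) S ∘ t).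
rewrite -[RHS]rsr /= /homotopy_mul -!compA; do 3!congr (_ ∘ _).
apply: (iso_mono (shift0_iso S)); rewrite !compA tt0 comp1m -shift0_nat.
by rewrite -compA shiftD0l compm1.
Qed.

(** Finite sums of shifts of [S] and their summands; retracts arise from
[SumSummand] with [i2 = 0]. *)
Inductive shift_summand : D -> Prop :=
| ShiftSummand i : shift_summand (shift i S)
| SumSummand X1 X2 X (i1 : Hom X1 X) (i2 : Hom X2 X)
    (p1 : Hom X X1) (p2 : Hom X X2) :
    i1 ∘ p1 + i2 ∘ p2 = idm X ->
    shift_summand X1 -> shift_summand X2 -> shift_summand X.

Lemma shift_summand_regular X Y :
  shift_summand X -> shift_summand Y -> regular_pair X Y.
Proof.
move=> + sY; elim=> [i|X1 X2 {}X i1 i2 p1 p2 ip _ reg1 _ reg2].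
  elim: sY => [j|Y1 Y2 {}Y i1 i2 p1 p2 ip _ reg1 _ reg2].
    exact: regular_pair_shift.
  exact: regular_pair_sumr ip reg1 reg2.
exact: regular_pair_suml ip reg1 reg2.
Qed.

Lemma shift_summand_retract X Y (i : Hom X Y) (r : Hom Y X) :
  r ∘ i = idm X -> shift_summand Y -> shift_summand X.
Proof.
move=> ri sY; apply: (@SumSummand Y Y X r 0 i 0 _ sY sY).
by rewrite comp0m addr0.
Qed.

Lemma shift_summand_shift X i : shift_summand X -> shift_summand (shift i X).
Proof.
elim=> [j|X1 X2 {}X i1 i2 p1 p2 ip _ s1 _ s2].
  have [d [dD Dd]] := shiftD_iso (erefl (i + j)) S.
  exact: shift_summand_retract Dd (ShiftSummand _).
apply: (@SumSummand _ _ _ (smap i i1) (smap i i2) (smap i p1) (smap i p2)) s1 s2.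
by rewrite -!smapM -smapD ip smap1.
Qed.

Lemma shift_summand_thick : thick_class shift_summand.
Proof.
apply: thick_class_of_cones.
- exact: shift_summand_shift.
- exact: shift_summand_retract.
move=> X Y Z f g h fgh sX sY.
have [s [t gsth]] := cone_regular_sum fgh (shift_summand_regular sX sY f).
exact: SumSummand gsth sY (shift_summand_shift 1 sX).
Qed.

Lemma shift_summand_ghost X Y (f : Hom X Y) : shift_summand X ->
  (forall i (x : homotopy S i X), f ∘ x = 0) -> f = 0.
Proof.
move=> sX; elim: sX f => [j|X1 X2 {}X i1 i2 p1 p2 ip _ IH1 _ IH2] f f0.
  by rewrite -(compm1 f) f0.
have f1 : f ∘ i1 = 0 by apply: IH1 => i x; rewrite -compA f0.
have f2 : f ∘ i2 = 0 by apply: IH2 => i x; rewrite -compA f0.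
by rewrite -(compm1 f) -ip compDr !compA f1 f2 !comp0m addr0.
Qed.

Lemma regular_generating_hypothesis : generating_hypothesis S.
Proof.
move=> X Y f tX _; apply: shift_summand_ghost.
apply: tX shift_summand_thick _.
have [t [t0 tt0]] := shift0_iso S.
exact: shift_summand_retract tt0 (ShiftSummand 0).
Qed.

End RegularImpliesGeneratingHypothesis.

(** * From the generating hypothesis to regularity *)

Section GeneratingHypothesisImpliesRegular.
Variables (D : triangulatedCategory) (S : D).
Hypothesis R_comm : graded_commutative (homotopy_ring S).
Hypothesis R_even : even_graded (homotopy_ring S).
Hypothesis GH : generating_hypothesis S.

(** If the sign is -1, both degrees are odd and both elements vanish. *)
Lemma homotopy_mulC i j l (e : i + j = l) (e' : j + i = l)
    (x : homotopy S i S) (y : homotopy S j S) :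
  homotopy_mul e x y = homotopy_mul e' y x.
Proof.
case odd_ij: (odd `|(i * j)%R|%N); last first.
  have := R_comm e e' x y; rewrite /= => ->.
  by rewrite -signr_odd odd_ij expr0 mulr1z.
have -> : x = 0.
  by apply: R_even; move: odd_ij; rewrite abszM oddM => /andP[].
by rewrite /homotopy_mul smap0 compm0 !comp0m.
Qed.

Lemma odd_homotopy_shift2 i j k (x : homotopy S i (Susp (shift j (shift k S)))) :
  odd `|(i - 1 - j - k)%R|%N -> x = 0.
Proof.
move=> odd_i.
have e1 : 1 + (i - 1) = i by lia.
have e2 : j + (i - 1 - j) = i - 1 by lia.
have e3 : k + (i - 1 - j - k) = i - 1 - j by lia.
have [x1 ->] := hom_shift e1 x; have [x2 ->] := hom_shift e2 x1.
have [x3 ->] := hom_shift e3 x2; have -> : x3 = 0 by apply: R_even.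
by rewrite !(smap0, comp0m).
Qed.

Lemma thick_sphere i : thick S (shift i S).
Proof. by move=> P tP; apply: thick_shift. Qed.

Lemma thick_shift_sphere i j : thick S (shift i (shift j S)).
Proof. by move=> P tP PS; apply: (thick_shift _ tP); apply: thick_sphere. Qed.

Lemma thick_cone X Y Z (f : Hom X Y) (g : Hom Y Z) (h : Hom Z (Susp X)) :
  exact f g h -> thick S X -> thick S Y -> thick S Z.
Proof.
by move=> fgh tX tY P tP PS; apply: (thick_exact3 tP fgh); [apply: tX | apply: tY].
Qed.

(** Let [C] be the cone of [n], with boundary [h], and [C'] the cone of [smap j n],
with boundary [h'].  Since [n * n = 0], the map [smap 1 (smap j n)] is
[h ∘ psi]; the composite [psi ∘ h'] of [C'] into [C] is zero on homotopy. *)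
Lemma homotopy_ring_reduced j (n : homotopy S j S) :
  homotopy_mul (erefl (j + j)) n n = 0 -> n = 0.
Proof.
move=> nn0; have n0 : n ∘ smap j n = 0.
  by apply: (iso_epi (shiftD_iso (erefl (j + j)) S)); rewrite comp0m.
have [C [p [h nph]]] := exact_cone n.
have [C' [p' [h' nph']]] := exact_cone (smap j n).
have thickS : thick S S by move=> P.
have thickC : thick S C := thick_cone nph (thick_sphere j) thickS.
have thickC' : thick S C' := thick_cone nph' (thick_shift_sphere j j) (thick_sphere j).
have [psi psiE] : exists psi, smap 1 (smap j n) = h ∘ psi.
  have := nph; move=> /exact_rot/exact_rot/exact_lift; apply.
  by rewrite compNm -smapM n0 smap0 oppr0.
(* For even [i] the element [h' ∘ y] has odd degree.  For odd [i], the element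
   [h ∘ psi ∘ h' ∘ y] is zero because consecutive maps of a triangle compose to
   zero, so [psi ∘ h' ∘ y] comes from an element [w] of odd degree. *)
have psih0 : psi ∘ h' = 0.
  apply: GH => // i y; case odd_i: (odd `|i|%N); last first.
    have -> : psi ∘ h' ∘ y = psi ∘ (h' ∘ y) by rewrite compA.
    by rewrite (@odd_homotopy_shift2 _ _ _ (h' ∘ y)) ?compm0 //; lia.
  have [|w ->] := @exact_lift _ _ _ _ _ _ _ _ (psi ∘ h' ∘ y)
    (proj1 (exact_rot _ _ _) nph).
    by rewrite !compA -psiE (exact_comp0_susp nph') comp0m.
  have -> : w = 0 by apply: R_even.
  exact: compm0.
have {psih0} [v psiv] : exists v, psi = v ∘ smap 1 (smap j n).
  move/exact_rot/exact_rot: nph' => /exact_extend/(_ psih0)[v ->].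
  by exists (- v); rewrite compNm compmN.
(* The map [h ∘ v] is the suspended shift of some [w], which satisfies
   [w ∘ n = n] by the choice of [v] and [n ∘ smap j w = 0] by exactness; these
   are the two products of [n] with the element [w ∘ shift0 S] of degree 0. *)
have [w1 w1E] := smap_full (h ∘ v); have [w wE] := smap_full w1.
have wn : w ∘ n = n.
  apply: (@smap_inj _ j); apply: (@smap_inj _ 1).
  by rewrite psiE psiv !smapM wE w1E compA.
have nw : n ∘ smap j w = 0.
  by apply: (@smap_inj _ 1); rewrite smapM wE w1E compA (exact_comp0_susp nph) comp0m smap0.
have := homotopy_mulC (add0r j) (addr0 j) (w ∘ shift0 S) n.
rewrite /homotopy_mul -(compA w) -shift0_nat -!compA shiftD0l compm1.
by rewrite smapM -(compA (smap j w)) shiftD0r compm1 nw wn.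
Qed.

(** The element [x * r] has square [(x * x) * r * r]. *)
Lemma homotopy_mul_sqr_eq0 (k m kk km l : int) (e : k + k = kk)
    (e1 : kk + m = l) (e2 : k + m = km) (x : homotopy S k S) (r : homotopy S m S) :
  homotopy_mul e1 (homotopy_mul e x x) r = 0 -> homotopy_mul e2 x r = 0.
Proof.
move=> xxr; apply: homotopy_ring_reduced.
have e3 : k + (m + km) = km + km by lia.
have e4 : km + m = m + km by lia.
have e5 : k + (m + m) = m + km by lia.
have e6 : kk + (m + m) = km + km by lia.
have e7 : l + m = km + km by lia.
rewrite -(homotopy_mulA e2 (erefl (km + km)) (erefl (m + km)) e3).
rewrite (homotopy_mulC _ e4) -(homotopy_mulA e2 e4 (erefl (m + m)) e5).
rewrite (homotopy_mulA e e6 e5 e3) (homotopy_mulA e1 e7 (erefl (m + m)) e6) xxr.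
by rewrite /homotopy_mul !comp0m.
Qed.

(** A map [S -> shift k S] amounts to an element [y] of degree [- k], and
composing with it amounts to multiplying by [y]. *)
Lemma comp_homotopy_mul k l m (e : k + m = l) (e1 : - k + l = m)
    (v : Hom S (shift k S)) (y : homotopy S (- k) S) (q : homotopy S l S) :
  v ∘ shift0 S = smap k y ∘ shiftD (subrr k) S ->
  v ∘ q = smap k (homotopy_mul e1 y q) ∘ shiftD e S.
Proof.
move=> vE; rewrite /homotopy_mul !smapM -!compA.
rewrite -(shiftDA (subrr k) (add0r l) e1).
rewrite (compA _ (shiftD (subrr k) _)) shiftD_nat -!compA (compA (smap k y)) -vE.
by rewrite -compA (compA (shift0 S)) -shift0_nat -compA shiftD0l compm1.
Qed.

Lemma homotopy_ring_regular : graded_regular (homotopy_ring S).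
Proof.
move=> k x /=; rewrite -/(homotopy S k S) in x *.
(* The element [x] as a map from [shift (k + k) S] to [shift k S]. *)
pose xs := smap k x ∘ shiftD (erefl (k + k)) S.
pose q := homotopy_mul (erefl (k + k)) x x.
have qE : q = x ∘ xs by rewrite /q /homotopy_mul compA.
have [C [p [h qph]]] := exact_cone q.
have thickS : thick S S by move=> P.
have thickC : thick S C := thick_cone qph (thick_sphere _) thickS.
(* The map [h ∘ y] corresponds to an element [r] with [x * x * r = 0]; then
   [x * r = 0] by reducedness. *)
have xh0 : smap 1 xs ∘ h = 0.
  apply: (GH thickC (thick_shift_sphere 1 k)) => i y.
  have e1 : 1 + (i - 1) = i by lia.
  have e2 : k + k + (i - 1 - (k + k)) = i - 1 by lia.
  have e3 : k + (i - 1 - (k + k)) = i - 1 - k by lia.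
  have e4 : k + (i - 1 - k) = i - 1 by lia.
  have [r1 r1E] := hom_shift e1 (h ∘ y).
  have [r rE] := hom_shift e2 r1.
  have qr : homotopy_mul e2 q r = 0.
    rewrite /homotopy_mul -compA -rE; apply: (@smap_inj _ 1).
    apply: (iso_epi (shiftD_iso e1 S)); rewrite smapM -compA -r1E compA.
    by rewrite (exact_comp0_susp qph) !(smap0, comp0m).
  have xr := homotopy_mul_sqr_eq0 e3 qr.
  rewrite -compA r1E compA -smapM rE.
  have -> : xs ∘ (smap (k + k) r ∘ shiftD e2 S)
      = smap k (homotopy_mul e3 x r) ∘ shiftD e4 S.
    rewrite /xs /homotopy_mul !smapM -!compA -(shiftDA (erefl (k + k)) e2 e3 e4).
    by rewrite (compA (shiftD _ S)) -shiftD_nat !compA.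
  by rewrite xr !(smap0, comp0m).
(* So [x], seen as [xs], factors through [q], and the factor is an element [y]. *)
have [v xsE] : exists v, smap 1 xs = v ∘ smap 1 q.
  move/exact_rot/exact_rot: qph => /exact_extend/(_ xh0)[v ->].
  by exists (- v); rewrite compNm compmN.
have [v' v'E] := smap_full v.
have {v v'E xsE} xsE : xs = v' ∘ q.
  by apply: (@smap_inj _ 1); rewrite smapM v'E.
have [y yE] := hom_shift (subrr k) (v' ∘ shift0 S).
have e1 : - k + (k + k) = k by lia.
have xE : x = homotopy_mul e1 y q.
  apply: (@smap_inj _ k); apply: (iso_epi (shiftD_iso (erefl (k + k)) S)).
  by rewrite -/xs xsE (comp_homotopy_mul (erefl (k + k)) e1 q yE).
exists y; rewrite [RHS]xE /q.
rewrite (homotopy_mulA (addNr k) (add0r k) (erefl (k + k)) e1).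
by rewrite (homotopy_mulC (addNr k) (subrr k)).
Qed.
End GeneratingHypothesisImpliesRegular.

Theorem mainTheorem3 (D : triangulatedCategory) (S : D)
    (hcoprod : has_coproducts D)
    (hcomm : graded_commutative (homotopy_ring S))
    (heven : even_graded (homotopy_ring S)) :
  generating_hypothesis S <-> graded_regular (homotopy_ring S).
Proof.
split; first exact: homotopy_ring_regular hcomm heven.
exact: regular_generating_hypothesis.
Qed.
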